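(* Let $V$ be a Euclidean vector space of even dimension with orthonormal basis $\{e_\mu\}$, and let $I_\alpha$ be pairwise disjoint multi-indices with $\big(\bigcup_\alpha I_\alpha\big)^{\complement}=\emptyset$. Consider $c,d$ with $$c=\sum_\alpha c_\alpha\Gamma_{I_\alpha}+\Gamma^*\sum_\alpha\hat c_\alpha\Gamma_{I_\alpha},\qquad d=\sum_\alpha \epsilon_\alpha c_\alpha\Gamma_{I_\alpha}+\Gamma^*\sum_\alpha\hat\epsilon_\alpha\hat c_\alpha\Gamma_{I_\alpha}$$ and $\epsilon_\alpha=-\hat\epsilon_\alpha=(-1)^{\hat I_\alpha}$. Then $(c,d)$ yields a non-degenerate quadratic Clifford pair if and only if it is of one of the following types: (1) All summands are even (i.e. all $\hat I_\alpha$ are even) with $\hat c_\alpha c_\alpha=0$ for all $\alpha$, i.e. only one of $\Gamma_{I_\alpha}$ and $\Gamma^*\Gamma_{I_\alpha}$ contributes to $c$ and $d$. (2) Two summands are odd, e.g. $\hat I_{\alpha_0},\hat I_{\alpha_1}$, and all others obey $\hat I_\alpha$ even with $\hat c_\alpha=0$, as well as $c_{\alpha_0}c_{\alpha_1}=\hat c_{\alpha_0}\hat c_{\alpha_1}$. For example, if $\hat c_{\alpha_0},c_{\alpha_1}\neq0$, then (with a scalar $\gamma$, and with the prefactors of the two odd terms again denoted by $c_{\alpha_0},c_{\alpha_1}$) $$c=c_{\alpha_0}(\gamma+\Gamma^* )\Gamma_{I_{\alpha_0}}+c_{\alpha_1}(1+\gamma\Gamma^* )\Gamma_{I_{\alpha_1}}+\sum_{\hat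 I_\alpha\text{ even}}c_\alpha\Gamma_{I_\alpha},$$ $$d=-c_{\alpha_0}(\gamma-\Gamma^* )\Gamma_{I_{\alpha_0}}-c_{\alpha_1}(1-\gamma\Gamma^* )\Gamma_{I_{\alpha_1}}+\sum_{\hat I_\alpha\text{ even}}c_\alpha\Gamma_{I_\alpha}.$$
   Context: $V$ is a finite-dimensional real vector space with Euclidean metric $g$, $n=\dim V$; $\mathrm{C}\ell(V)$ is its complex Clifford algebra with relation $vw+wv=-2g(v,w)$. $\Gamma_\mu$ denotes (the image under an irreducible matrix representation of) $e_\mu$ in $\mathrm{C}\ell(V)$. For a multi-index $I=(i_1,\dots,i_k)$ of pairwise distinct indices in $\{1,\dots,n\}$ put $\Gamma_I=\Gamma_{i_1}\cdots\Gamma_{i_k}$ and $\hat I=k$; multi-indices are identified with the sets of their entries when set operations are used, and $^\complement$ is the complement in $\{1,\dots,n\}$. $\Gamma^*=i^{\lfloor (n+1)/2\rfloor}\Gamma_1\cdots\Gamma_n$, so $(\Gamma^* )^2=1$. The $c_\alpha,\hat c_\alpha$ are scalars. For $a,b\in \mathrm{C}\ell(V)$ define $q_{a,b}(x)=a^2x+xb^2-2axb$. A pair $(a,b)$ is a quadratic Clifford pair if $q_{a,b}(V)\subset V$ and $q_{a,b}|_V$ is a $g$-symmetric endomorphism of $V$; it is non-degenerate if $q_{a,b}|_V$ is non-degenerate.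
   Formalization: Multi-indices are non-empty; types (1),(2) come with the condition that each c_α²+ε_αĉ_α² is a nonzero real (else q is degenerate or leaves V); ''only if'' excludes odd summands being exactly two single vectors, where c_{α0}c_{α1}=ĉ_{α0}ĉ_{α1} can fail. *)

(* Defs.v *)
From HB Require Import structures.
From mathcomp Require Import all_boot all_order all_algebra.
From mathcomp Require Import sesquilinear.
From mathcomp Require Import reals.
From mathcomp Require Export complex.

Set Implicit Arguments.
Unset Strict Implicit.
Unset Printing Implicit Defensive.

Import Order.TTheory GRing.Theory Num.Theory.
Local Open Scope ring_scope.
Local Open Scope complex_scope.

Section CliffordPairs.
Variables (R : realType) (V : vectType R) (g : {dot V for idfun}).

Definition clifford_map (B : algType R[i]) (f : V -> B) : Prop :=
  (forall (r : R) (u v : V), f (r *: u + v) = r%:C *: f u + f v) /\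
  (forall v w : V, f v * f w + f w * f v = ((- 2%:R * g v w)%:C)%:A).

(* The complex Clifford algebra of (V, g), given by its universal property
   among unital complex algebras. *)
Definition clifford_algebra (Cl : algType R[i]) (iota : V -> Cl) : Prop :=
  clifford_map iota /\
  forall (B : algType R[i]) (f : V -> B), clifford_map f ->
    exists phi : {lrmorphism Cl -> B},
      (forall v, phi (iota v) = f v) /\
      (forall psi : {lrmorphism Cl -> B},
         (forall v, psi (iota v) = f v) -> psi =1 phi).

Section Pairs.
Variables (Cl : algType R[i]) (iota : V -> Cl).

Definition quad (a b x : Cl) : Cl := a ^+ 2 * x + x * b ^+ 2 - 2%:R * (a * x * b).

(* [f] is the restriction of [quad a b] to V; as [iota] is injective on a
   Clifford algebra, such an [f] exists iff [quad a b] maps V to V, and it is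
   then unique. *)
Definition quad_restr (a b : Cl) (f : 'End(V)) : Prop :=
  forall v, quad a b (iota v) = iota (f v).

Definition g_symmetric (f : 'End(V)) : Prop :=
  forall v w, g (f v) w = g v (f w).

Definition quadratic_clifford_pair (a b : Cl) : Prop :=
  exists f : 'End(V), quad_restr a b f /\ g_symmetric f.

Definition nondeg_quadratic_clifford_pair (a b : Cl) : Prop :=
  quadratic_clifford_pair a b /\
  (forall f : 'End(V), quad_restr a b f -> lker f = 0%VS).

Variables (n : nat) (e : n.-tuple V).

Definition Gamma (mu : 'I_n) : Cl := iota (tnth e mu).

Definition GammaI (s : seq 'I_n) : Cl := \prod_(mu <- s) Gamma mu.

Definition GammaStar : Cl := ('i ^+ (n.+1)./2) *: \prod_(mu < n) Gamma mu.

Variables (A : finType) (I : A -> seq 'I_n) (c ch : A -> R[i]).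

Definition eps (a : A) : R[i] := (-1) ^+ size (I a).

Definition epsh (a : A) : R[i] := - eps a.

Definition pair_c : Cl :=
  \sum_a c a *: GammaI (I a) + GammaStar * \sum_a ch a *: GammaI (I a).

Definition pair_d : Cl :=
  \sum_a (eps a * c a) *: GammaI (I a)
  + GammaStar * \sum_a (epsh a * ch a) *: GammaI (I a).

End Pairs.

Section Types.
Variables (n : nat) (A : finType) (I : A -> seq 'I_n) (c ch : A -> R[i]).

Definition type1 : Prop :=
  (forall a, ~~ odd (size (I a))) /\ (forall a, ch a * c a = 0).

Definition type2_at (a0 a1 : A) : Prop :=
  [/\ a0 != a1, odd (size (I a0)), odd (size (I a1)),
      forall a, a != a0 -> a != a1 -> ~~ odd (size (I a)) /\ ch a = 0 &
      c a0 * c a1 = ch a0 * ch a1].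

Definition type2 : Prop := exists a0 a1, type2_at a0 a1.

(* For the pairs of types 1 and 2, [quad] acts on the span of the e_mu with
   mu in I_a as +-4 (c_a^2 + (-1)^|I_a| ch_a^2).  On the real space V this has
   to be a real number, and it is nonzero iff [quad] is non-degenerate there.
   For real coefficients this says: in type 1, that exactly one of c_a and ch_a
   is nonzero; in type 2, moreover c_a <> +-ch_a for the two odd summands
   (gamma <> +-1). *)
Definition proper_summands : Prop :=
  forall a, exists2 r : R, r != 0 & c a ^+ 2 + eps I a * ch a ^+ 2 = r%:C.

(* The only odd summands are two vectors.  The product Gamma_I0 Gamma_I1 e_mu
   is then again a vector, so c_0 c_1 = ch_0 ch_1 need not hold. *)
Definition odd_part_two_vectors : Prop :=
  exists a0 a1, [/\ a0 != a1, size (I a0) = 1%N, size (I a1) = 1%N &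
    forall a, a != a0 -> a != a1 -> ~~ odd (size (I a))].

End Types.

End CliffordPairs.

(* Main.v *)
(* Write c = sum_a T_a with T_a = c_a Gamma_{I_a} + ch_a Gamma^* Gamma_{I_a}.
   If mu lies in I_a, then e_mu d = (c - 2 T_a) e_mu, whence
     q(e_mu) = (4 T_a^2 + 2 sum_b [T_b, T_a]) e_mu.
   Here T_a^2 is a combination of 1 and Gamma^*, and [T_b, T_a] is a combination
   of Gamma_{I_b} Gamma_{I_a} and Gamma^* Gamma_{I_b} Gamma_{I_a}.  In even
   dimension conjugation by the e_mu separates all these monomials, so the
   coefficients of everything that is not a vector must vanish.

   An even block a and an odd block b give ch_a c_b = ch_a ch_b = 0; as q kills
   I_b if c_b = ch_b = 0, this means that ch_a = 0 once there is an odd block.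
   Two odd blocks that are not both single vectors have to be orthogonal for the
   form c_a c_b - ch_a ch_b.  Hence, on one vector from each odd block, q is up
   to signs the Gram matrix of the vectors (c_a, ch_a) of C^2, which is singular
   for three or more of them; and the number of odd blocks is even since n is. *)

Require Import Defs.
From HB Require Import structures.
From mathcomp Require Import all_boot all_order all_algebra.
From mathcomp Require Import sesquilinear.
From mathcomp Require Import reals.
From mathcomp Require Import ring lra.

Set Implicit Arguments.
Unset Strict Implicit.
Unset Printing Implicit Defensive.

Import Order.TTheory GRing.Theory Num.Theory.
Local Open Scope ring_scope.
Local Open Scope complex_scope.

(** * Monomials in anticommuting square roots of -1 *)

Section CliffordMonomials.
Variables (F : numFieldType) (B : algType F) (n : nat) (Gm : 'I_n -> B).
Hypothesis Gm_sqr : forall mu, Gm mu * Gm mu = -1.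
Hypothesis Gm_anti : forall mu nu, mu != nu -> Gm mu * Gm nu = - (Gm nu * Gm mu).

Definition monom (s : seq 'I_n) : B := \prod_(mu <- s) Gm mu.

Lemma monom_cons mu s : monom (mu :: s) = Gm mu * monom s.
Proof. by rewrite /monom big_cons. Qed.

Lemma scale1_inj (a b : F) : a%:A = b%:A :> B -> a = b.
Proof.
move=> /eqP; rewrite -subr_eq0 -scalerBl scaler_eq0 oner_eq0 orbF subr_eq0.
by move/eqP.
Qed.

(* The sign character by which conjugation by the [Gm mu] acts on [x]. *)
Definition typed (chi : pred 'I_n) (x : B) : Prop :=
  forall mu, Gm mu * x = (-1) ^+ chi mu *: (x * Gm mu).

Lemma eq_typed chi1 chi2 x : chi1 =1 chi2 -> typed chi1 x -> typed chi2 x.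
Proof. by move=> e tx mu; rewrite tx e. Qed.

Lemma typedZ chi a x : typed chi x -> typed chi (a *: x).
Proof. by move=> tx mu; rewrite -scalerAr tx -scalerAl !scalerA mulrC. Qed.

Lemma typedM chi1 chi2 x y : typed chi1 x -> typed chi2 y ->
  typed (fun mu => chi1 mu (+) chi2 mu) (x * y).
Proof.
move=> tx ty mu.
rewrite mulrA tx -scalerAl -[x * Gm mu * y]mulrA ty -scalerAr scalerA mulrA.
by rewrite signr_addb.
Qed.

Lemma typed1 : typed pred0 1.
Proof. by move=> mu; rewrite mulr1 mul1r scale1r. Qed.

Lemma typed_Gm nu : typed (fun mu => mu != nu) (Gm nu).
Proof.
move=> mu; case: eqP => [->|/eqP ne] /=; first by rewrite scale1r.
by rewrite Gm_anti // expr1 scaleN1r.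
Qed.

(** [Gm mu] anticommutes with every factor except itself, so the signs number the length of [s],
    less one if [mu] occurs. *)
Lemma typed_monom s : uniq s ->
  typed (fun mu => odd (size s) (+) (mu \in s)) (monom s).
Proof.
elim: s => [_|nu s IHs /= /andP[nus us]].
  by rewrite /monom big_nil; apply: eq_typed typed1.
rewrite monom_cons; apply: eq_typed (typedM (typed_Gm nu) (IHs us)) => mu.
rewrite in_cons; case: eqP => [->|_] /=; last by rewrite addNb.
by rewrite (negPf nus) /= addbF addbT negbK.
Qed.

(** [b] records whether all generators of [t] anticommute with [x] or all commute with it. *)
Lemma monom_swap (b : bool) t x :
    (forall mu, mu \in t -> Gm mu * x = (-1) ^+ b *: (x * Gm mu)) ->
  monom t * x = (-1) ^+ (b && odd (size t)) *: (x * monom t).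
Proof.
elim: t => [_|mu t IHt H].
  by rewrite /monom big_nil mulr1 mul1r andbF scale1r.
rewrite monom_cons -mulrA IHt => [|nu nut]; last first.
  by apply: H; rewrite in_cons nut orbT.
rewrite -scalerAr (mulrA (Gm mu)) H ?mem_head // -scalerAl scalerA -mulrA.
by rewrite -signr_addb /=; case: b {H IHt}; rewrite //= addbT.
Qed.

Lemma monom_disjoint_swap s t : uniq s -> [disjoint s & t] ->
  monom t * monom s = (-1) ^+ (odd (size s) && odd (size t)) *: (monom s * monom t).
Proof.
move=> us dst; apply: monom_swap => mu mut; rewrite typed_monom //.
by rewrite (disjointFl dst mut) addbF.
Qed.

(** Reversing a word of length k costs k(k-1)/2 signs and the k squares give k more; the binomial is
    their sum. *)
Lemma monom_sqr s : uniq s ->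
  monom s * monom s = ((-1) ^+ 'C((size s).+1, 2))%:A.
Proof.
elim: s => [_|mu s IHs /= /andP[mus us]].
  by rewrite /monom big_nil mulr1 scale1r.
rewrite monom_cons -mulrA (mulrA (monom s)).
have -> : monom s * Gm mu = (-1) ^+ odd (size s) *: (Gm mu * monom s).
  by rewrite typed_monom // (negPf mus) addbF scalerA -signr_addb addbb scale1r.
rewrite -scalerAl -scalerAr -mulrA IHs // mulrA Gm_sqr mulN1r scalerN scalerA.
(* Pascal's rule with k = [size s]: k signs come from the swap, one from the square of [Gm mu]. *)
by rewrite -scaleNr [in RHS]binS bin1 exprD signr_odd exprS mulN1r mulrN mulrC.
Qed.

(* The projection of [x] on the component of type [chi], for the [Gm mu]
   acting by conjugation: note that the inverse of [Gm mu] is [- Gm mu]. *)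
Definition proj (chi : pred 'I_n) (x : B) : B :=
  foldr (fun mu y => 2^-1 *: (y - (-1) ^+ chi mu *: (Gm mu * y * Gm mu))) x (enum 'I_n).

Fact proj_is_linear chi : linear (proj chi).
Proof.
move=> a x y; rewrite /proj; elim: (enum _) => //= mu s ->.
rewrite mulrDr mulrDl -scalerAr -scalerAl [_ ^+ _ *: (_ + _)]scalerDr.
rewrite (scalerA _ a) (mulrC _ a) -(scalerA a) opprD addrACA -scalerBr scalerDr.
by rewrite !scalerA (mulrC _ a).
Qed.

HB.instance Definition _ chi := GRing.isLinear.Build F B B _ (proj chi) (proj_is_linear chi).

Lemma Gm_conj chi x mu : typed chi x -> Gm mu * x * Gm mu = (-1) ^+ (~~ chi mu) *: x.
Proof.
by move=> tx; rewrite tx -scalerAl -mulrA Gm_sqr mulrN1 scalerN -scaleNr signrN.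
Qed.

Lemma proj_id chi1 chi2 x : chi1 =1 chi2 -> typed chi1 x -> proj chi2 x = x.
Proof.
move=> e tx; rewrite /proj; elim: (enum _) => //= mu s ->.
rewrite (Gm_conj _ tx) scalerA -signr_addb e addbN addbb /= expr1 scaleN1r.
by rewrite opprK -mulr2n -scaler_nat scalerA mulVf ?scale1r ?pnatr_eq0.
Qed.

(** Every factor of [proj] preserves the type of [x], and the factor at [mu], where the characters
    differ, kills it. *)
Lemma proj_eq0 chi1 chi2 x mu : chi1 mu != chi2 mu -> typed chi1 x -> proj chi2 x = 0.
Proof.
move=> ne tx; have := mem_enum 'I_n mu; rewrite /proj.
have key (y : B) nu : typed chi1 y -> typed chi1 (2^-1 *: (y - (-1) ^+ chi2 nu *: (Gm nu * y * Gm nu))).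
  move=> ty; rewrite (Gm_conj _ ty) scalerA -{1}(scale1r y) -scalerBl.
  by do 2![apply: typedZ].
have t s : typed chi1 (foldr (fun mu y => 2^-1 *: (y - (-1) ^+ chi2 mu *: (Gm mu * y * Gm mu))) x s).
  by elim: s => //= nu s; apply: key.
elim: (enum _) => //= nu s IHs; rewrite in_cons => /orP[/eqP <-|/IHs ->]; last first.
  by rewrite mulr0 mul0r scaler0 subr0 scaler0.
rewrite (Gm_conj _ (t s)) scalerA -signr_addb.
have -> : chi2 mu (+) ~~ chi1 mu = false by move: ne; case: (chi1 mu); case: (chi2 mu).
by rewrite scale1r subrr scaler0.
Qed.

(** Characters of different parity differ somewhere; this coarse invariant discards many terms at
    once. *)
Lemma proj_parity chi1 chi2 x : odd #|chi1| != odd #|chi2| -> typed chi1 x -> proj chi2 x = 0.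
Proof.
move=> odd_ne tx; have [mu|chi_eq] := pickP (fun mu => chi1 mu != chi2 mu).
  by move=> ne; apply: proj_eq0 ne tx.
by rewrite (@eq_card _ chi1 chi2) ?eqxx // in odd_ne => mu; apply/eqP/negbFE/chi_eq.
Qed.

Lemma odd_cardE (p : pred 'I_n) : odd #|p| = \big[addb/false]_mu p mu.
Proof.
rewrite -sum1_card big_mkcond (big_morph odd oddD (erefl _)).
by apply: eq_bigr => mu _; rewrite unfold_in; case: (p mu).
Qed.

Lemma odd_card_addb (p q : pred 'I_n) :
  odd #|(fun mu => p mu (+) q mu) : pred 'I_n| = odd #|p| (+) odd #|q|.
Proof. by rewrite !odd_cardE big_split. Qed.

Hypothesis n_even : ~~ odd n.

(** The monomial anticommutes with the indices in [s] if its length is even, with those outside if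
    it is odd. As n is even, both sets have the parity of the length. *)
Lemma odd_card_typed_monom s : uniq s ->
  odd #|(fun mu => odd (size s) (+) (mu \in s)) : pred 'I_n| = odd (size s).
Proof.
move=> us; rewrite odd_card_addb.
have -> : odd #|(fun mu => mu \in s) : pred 'I_n| = odd (size s).
  by rewrite (card_uniqP us).
case: (odd (size s)); last by rewrite (@eq_card0 _ (fun=> false)).
by rewrite (@eq_card _ _ 'I_n) // card_ord (negPf n_even).
Qed.

Lemma odd_card_typed_Gm (nu : 'I_n) : odd #|(fun mu => mu != nu) : pred 'I_n|.
Proof.
rewrite (@eq_card _ _ (predC1 nu)) // cardC1 card_ord.
by move: n_even; case: (n) nu => [[]//|m _] /=; rewrite negbK.
Qed.

Variable Gs : B.
Hypothesis Gs_sqr : Gs * Gs = 1.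
Hypothesis Gs_anti : forall mu, Gm mu * Gs = - (Gs * Gm mu).

Lemma typed_Gs : typed predT Gs.
Proof. by move=> mu; rewrite Gs_anti expr1 scaleN1r. Qed.

Lemma monom_Gs s : monom s * Gs = (-1) ^+ odd (size s) *: (Gs * monom s).
Proof. by rewrite (@monom_swap true) // => mu _; rewrite typed_Gs. Qed.

(** [p] commutes with [Gs] up to sign and [Gs] squares to 1. Squares and commutators of blocks both
    reduce to this rule. *)
Lemma mul_Gs_pair (b : bool) p q x1 y1 x2 y2 : p * Gs = (-1) ^+ b *: (Gs * p) ->
  (x1 *: p + y1 *: (Gs * p)) * (x2 *: q + y2 *: (Gs * q)) =
  (x1 * x2 + (-1) ^+ b * y1 * y2) *: (p * q) +
  ((-1) ^+ b * x1 * y2 + y1 * x2) *: (Gs * (p * q)).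
Proof.
move=> pG; have pGq : p * (Gs * q) = (-1) ^+ b *: (Gs * (p * q)).
  by rewrite mulrA pG -scalerAl mulrA.
have GpGq : Gs * p * (Gs * q) = (-1) ^+ b *: (p * q).
  by rewrite -mulrA pGq -scalerAr (mulrA Gs Gs) Gs_sqr mul1r.
rewrite mulrDl !mulrDr -!scalerAl -!scalerAr pGq GpGq -(mulrA Gs) !scalerA.
rewrite [(y1 * x2) *: _ + _]addrC addrACA -!scalerDl.
by congr (_ *: _ + _ *: _); ring.
Qed.

(** * Block decomposition of the quadratic map *)

Variables (A : finType) (I : A -> seq 'I_n).
Hypothesis I_uniq : forall a, uniq (I a).
Hypothesis I_disj : forall a b, a != b -> [disjoint I a & I b].
Variables c ch : A -> F.

Local Notation P a := (monom (I a)).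
Local Notation odd_block a := (odd (size (I a))).

Definition block_sign a : F := (-1) ^+ 'C((size (I a)).+1, 2).

Definition block_square a : F :=
  block_sign a * (c a ^+ 2 + (-1) ^+ odd_block a * ch a ^+ 2).

(** A symmetric bilinear form on the coefficient vectors (c, ch); on an odd block its quadratic form
    is [block_square] up to [block_sign]. *)
Definition block_pairing b a : F := c b * c a - ch b * ch a.

Definition blk a : B := c a *: P a + ch a *: (Gs * P a).

Definition blk_twist a : B := (-1) ^+ odd_block a *: (c a *: P a - ch a *: (Gs * P a)).

Definition blocks : B := \sum_a blk a.

Definition blocks_twist : B := \sum_a blk_twist a.

Lemma blocksE : blocks = \sum_a c a *: P a + Gs * \sum_a ch a *: P a.
Proof.
rewrite mulr_sumr -big_split; apply: eq_bigr => a _ /=.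
by rewrite -scalerAr.
Qed.

Lemma blocks_twistE : blocks_twist =
  \sum_a ((-1) ^+ size (I a) * c a) *: P a +
  Gs * \sum_a (- (-1) ^+ size (I a) * ch a) *: P a.
Proof.
rewrite mulr_sumr -big_split; apply: eq_bigr => a _ /=.
by rewrite -scalerAr /blk_twist scalerBr !scalerA signr_odd mulNr scaleNr.
Qed.

Definition quad_coef a : B :=
  4%:R *: (blk a * blk a) + 2%:R *: \sum_(b | b != a) (blk b * blk a - blk a * blk b).

Lemma mem_other_block a b mu : mu \in I a -> b != a -> mu \in I b = false.
Proof. by move=> mua ba; rewrite (disjointFl (I_disj ba) mua). Qed.

(** The outer sign of the twist cancels the parity of the block, and its inner minus the sign from
    [Gs]; only membership of [mu] remains. This explains the choice of the epsilons. *)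
Lemma Gm_blk_twist mu a : Gm mu * blk_twist a = (-1) ^+ (mu \in I a) *: (blk a * Gm mu).
Proof.
have GmP : Gm mu * P a = (-1) ^+ (odd_block a (+) (mu \in I a)) *: (P a * Gm mu).
  exact: typed_monom.
have GmGsP : Gm mu * (Gs * P a) =
    - ((-1) ^+ (odd_block a (+) (mu \in I a)) *: (Gs * P a * Gm mu)).
  by rewrite mulrA Gs_anti mulNr -(mulrA Gs (Gm mu)) GmP -scalerAr mulrA.
rewrite /blk_twist -scalerAr mulrBr -!scalerAr GmP GmGsP mulrDl -!scalerAl.
rewrite scalerN opprK !scalerDr !scalerA.
congr (_ *: _ + _ *: _); by rewrite mulrAC -signr_addb addbA addbb addFb.
Qed.

Lemma Gm_blocks_twist mu a : mu \in I a ->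
  Gm mu * blocks_twist = (blocks - 2%:R *: blk a) * Gm mu.
Proof.
move=> mua; rewrite mulr_sumr mulrBl mulr_suml (bigD1 a) //= [in RHS](bigD1 a) //=.
rewrite Gm_blk_twist mua expr1 scaleN1r -scalerAl.
rewrite scaler_nat mulr2n opprD addrACA subrr add0r addrC; congr (_ + _).
by apply: eq_bigr => b ba; rewrite Gm_blk_twist (mem_other_block mua ba) scale1r.
Qed.

(** For S = [blocks] and U twice a block, this is the quadratic map once [Gm mu] has been moved to
    the right. *)
Lemma sqr_sub_double (S U : B) :
  S * S + (S - U) * (S - U) - 2%:R * (S * (S - U)) = U * U + (S * U - U * S).
Proof.
apply/eqP; rewrite subr_eq mulr_natl mulr2n !mulrBr !mulrBl opprB !addrA.
by rewrite [X in _ == X](ACl (4*6*3*1*7*2*5)) /= addrK.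
Qed.

Lemma quad_Gm mu a : mu \in I a ->
  blocks ^+ 2 * Gm mu + Gm mu * blocks_twist ^+ 2
    - 2%:R * (blocks * Gm mu * blocks_twist) = quad_coef a * Gm mu.
Proof.
move=> mua; have GD := Gm_blocks_twist mua.
have -> : Gm mu * blocks_twist ^+ 2 =
    (blocks - 2%:R *: blk a) * (blocks - 2%:R *: blk a) * Gm mu.
  by rewrite expr2 mulrA GD -mulrA GD mulrA.
have -> : blocks * Gm mu * blocks_twist = blocks * (blocks - 2%:R *: blk a) * Gm mu.
  by rewrite -mulrA GD mulrA.
rewrite expr2 (mulrA 2%:R) -mulrDl -mulrBl; congr (_ * _); rewrite /quad_coef.
have -> : \sum_(b | b != a) (blk b * blk a - blk a * blk b) = blocks * blk a - blk a * blocks.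
  rewrite mulr_suml mulr_sumr -sumrB [RHS](bigD1 a) //= subrr add0r.
  by apply: eq_bigr.
rewrite sqr_sub_double -!scalerAl -!scalerAr scalerA -scalerBr.
by rewrite -natrM.
Qed.

Lemma block_sign_sqr a : block_sign a * block_sign a = 1.
Proof. by rewrite /block_sign -expr2 sqrr_sign. Qed.

Lemma monom_block_sqr a : P a * P a = (block_sign a)%:A.
Proof. exact: monom_sqr. Qed.

Lemma blk_sqr a : blk a * blk a =
  (block_square a)%:A +
  (block_sign a * (c a * ch a * (1 + (-1) ^+ odd_block a))) *: Gs.
Proof.
rewrite /blk (mul_Gs_pair _ _ _ _ _ (monom_Gs _)) monom_block_sqr -scalerAr mulr1.
by rewrite !scalerA /block_square; congr (_ *: _ + _ *: _); ring.
Qed.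

(** Boolean multiples select the parities: two even blocks commute, two odd ones give the pairing,
    and mixed ones only products containing the [ch] of the even block. *)
Definition comm_coef b a : F :=
  2%:R * (block_pairing b a *+ (odd_block b && odd_block a)
    + ch b * ch a *+ (~~ odd_block b && odd_block a)
    - ch b * ch a *+ (odd_block b && ~~ odd_block a)).

Definition comm_coef_Gs b a : F :=
  2%:R * (ch b * c a *+ (~~ odd_block b && odd_block a)
    - c b * ch a *+ (odd_block b && ~~ odd_block a)).

Lemma blk_comm b a : b != a -> blk b * blk a - blk a * blk b =
  comm_coef b a *: (P b * P a) + comm_coef_Gs b a *: (Gs * (P b * P a)).
Proof.
move=> ba; rewrite /blk !(mul_Gs_pair _ _ _ _ _ (monom_Gs _)).
rewrite (monom_disjoint_swap (I_uniq b) (I_disj ba)) -scalerAr !scalerA opprD addrACA -!scalerBl.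
rewrite /comm_coef /comm_coef_Gs /block_pairing.
by case: (odd_block b); case: (odd_block a); congr (_ *: _ + _ *: _) => /=; ring.
Qed.

Definition chi a : pred 'I_n := fun mu => odd_block a (+) (mu \in I a).

Definition chi2 b a : pred 'I_n := fun mu => chi b mu (+) chi a mu.

Lemma typed_blk2 b a : typed (chi2 b a) (P b * P a).
Proof. by apply: typedM; apply: typed_monom. Qed.

Lemma typed_Gs_blk2 b a : typed (fun mu => ~~ chi2 b a mu) (Gs * (P b * P a)).
Proof. exact: typedM typed_Gs (typed_blk2 b a). Qed.

Lemma odd_card_chi2 b a : odd #|chi2 b a| = odd_block b (+) odd_block a.
Proof. by rewrite odd_card_addb !odd_card_typed_monom. Qed.

Lemma odd_card_chi2C b a :
  odd #|(fun mu => ~~ chi2 b a mu) : pred 'I_n| = odd_block b (+) odd_block a.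
Proof.
rewrite (odd_card_addb predT) odd_card_chi2.
by rewrite (@eq_card _ _ 'I_n) // card_ord (negPf n_even).
Qed.

(** Monomials square to a sign, hence are invertible. *)
Lemma scale_blk2_eq0 x b a : x *: (P b * P a) = 0 -> x = 0.
Proof.
move=> /(congr1 (fun y => P b * y * P a)); rewrite mulr0 mul0r.
rewrite -scalerAr -scalerAl (mulrA (P b)) -(mulrA (P b * P b)) !monom_block_sqr -scalerAr mulr1 !scalerA.
move/eqP; rewrite scaler_eq0 oner_eq0 orbF !mulf_eq0 /block_sign !signr_eq0 !orbF.
by move/eqP.
Qed.

Lemma scale_Gs_eq0 x (y : B) : x *: (Gs * y) = 0 -> x *: y = 0.
Proof.
by move=> /(congr1 ( *%R Gs)); rewrite mulr0 -scalerAr mulrA Gs_sqr mul1r.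
Qed.

(** The coefficient of [Gs] in [quad_coef a]. *)
Definition full_coef a : F :=
  4%:R * (block_sign a * (c a * ch a * (1 + (-1) ^+ odd_block a))).

Lemma quad_coefE a : quad_coef a = (4%:R * block_square a)%:A + full_coef a *: Gs +
  \sum_(b | b != a) ((2%:R * comm_coef b a) *: (P b * P a) +
                     (2%:R * comm_coef_Gs b a) *: (Gs * (P b * P a))).
Proof.
rewrite /quad_coef blk_sqr scalerDr !scalerA /full_coef; congr (_ + _).
rewrite scaler_sumr; apply: eq_bigr => b ba.
by rewrite (blk_comm ba) scalerDr !scalerA.
Qed.

(** Multiplying by [Gm mu], which squares to -1, makes both sides comparable type by type. *)
Lemma quad_coef_pairs mu a (z : 'I_n -> F) :
    quad_coef a * Gm mu = \sum_nu z nu *: Gm nu ->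
  quad_coef a = \sum_nu (- z nu) *: (Gm nu * Gm mu).
Proof.
move=> qz; have -> : quad_coef a = - (quad_coef a * Gm mu * Gm mu).
  by rewrite -mulrA Gm_sqr mulrN1 opprK.
rewrite qz mulr_suml -sumrN; apply: eq_bigr => nu _.
by rewrite scaleNr -scalerAl.
Qed.

(** * Comparison of coefficients by type and parity *)

Lemma typed_Gm2 nu mu : typed (fun k => (k != nu) (+) (k != mu)) (Gm nu * Gm mu).
Proof. exact: typedM (typed_Gm nu) (typed_Gm mu). Qed.

Lemma odd_card_typed_Gm2 (nu mu : 'I_n) :
  odd #|(fun k => (k != nu) (+) (k != mu)) : pred 'I_n| = false.
Proof.
by rewrite (odd_card_addb (fun k => k != nu)) !odd_card_typed_Gm.
Qed.

Lemma odd_cardT : odd #|(predT : pred 'I_n)| = false.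
Proof. by rewrite (@eq_card _ _ 'I_n) // card_ord (negPf n_even). Qed.

Lemma odd_card0 : odd #|(pred0 : pred 'I_n)| = false.
Proof. by rewrite card0. Qed.

(** 1, [Gs] and products of two generators have even parity, so an odd type sees only the
    commutators of blocks. *)
Lemma proj_quad_coef_odd (chi0 : pred 'I_n) mu a (z : 'I_n -> F) :
    odd #|chi0| -> quad_coef a * Gm mu = \sum_nu z nu *: Gm nu ->
  \sum_(b | b != a) ((2%:R * comm_coef b a) *: proj chi0 (P b * P a) +
    (2%:R * comm_coef_Gs b a) *: proj chi0 (Gs * (P b * P a))) = 0.
Proof.
move=> oc /quad_coef_pairs/(congr1 (proj chi0)).
rewrite quad_coefE !linearD !linear_sum /= !linearZ /=.
rewrite (proj_parity _ typed1) ?odd_card0 ?oc // (proj_parity _ typed_Gs) ?odd_cardT ?oc //.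
rewrite !scaler0 !add0r [RHS]big1 => [E|nu _]; last first.
  by rewrite linearZ /= (proj_parity _ (typed_Gm2 _ _)) ?scaler0 // odd_card_typed_Gm2 oc.
by rewrite -[RHS]E; apply: eq_bigr => b _; rewrite linearD !linearZ.
Qed.

Hypothesis I_neq0 : forall a, I a != [::].

Lemma mem_block a : exists mu, mu \in I a.
Proof. by case: (I a) (I_neq0 a) => // mu s _; exists mu; rewrite mem_head. Qed.

Lemma chi2_left b a mu : b != a -> mu \in I b -> chi2 b a mu = ~~ (odd_block b (+) odd_block a).
Proof.
move=> ba mub; rewrite /chi2 /chi mub (mem_other_block mub _) 1?eq_sym //.
by rewrite addbF addbT addNb.
Qed.

Lemma chi2_right b a mu : b != a -> mu \in I a -> chi2 b a mu = ~~ (odd_block b (+) odd_block a).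
Proof.
by move=> ba mua; rewrite /chi2 /chi mua (mem_other_block mua _) // addbF addbT addbN.
Qed.

Lemma chi2_out b a mu : mu \notin I b -> mu \notin I a -> chi2 b a mu = odd_block b (+) odd_block a.
Proof. by move=> /negPf nb /negPf na; rewrite /chi2 /chi nb na !addbF. Qed.

(** The types of [P b * P a] and of its product with [Gs] are both odd; projecting onto each
    isolates one commutator coefficient. Even blocks drop out since they commute with [blk a]. *)
Lemma even_block_ch mu a b (z : 'I_n -> F) :
    quad_coef a * Gm mu = \sum_nu z nu *: Gm nu ->
    ~~ odd_block a -> odd_block b -> ch a * c b = 0 /\ ch a * ch b = 0.
Proof.
move=> qz ea ob; have ba : b != a by apply: contraNneq ea => <-.
have ne0 : 2%:R * 2%:R != 0 :> F by rewrite mulf_eq0 pnatr_eq0.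
have even0 b' : ~~ odd_block b' -> (comm_coef b' a = 0) * (comm_coef_Gs b' a = 0).
  by move=> eb; rewrite /comm_coef /comm_coef_Gs (negPf ea) (negPf eb) !mulr0n addr0 subrr mulr0.
(* At a point of [I b'] the types [chi2 b' a] and [chi2 b a] differ; at a point of [I a] they agree,
   so each differs there from the complement of the other. *)
have sep b' : b' != a -> b' != b -> odd_block b' ->
    (proj (chi2 b a) (P b' * P a) = 0) * (proj (chi2 b a) (Gs * (P b' * P a)) = 0) *
    ((proj (fun k => ~~ chi2 b a k) (P b' * P a) = 0) *
     (proj (fun k => ~~ chi2 b a k) (Gs * (P b' * P a)) = 0)).
  move=> b'a b'b ob'.
  have [mu1 mu1b'] := mem_block b'; have [mu2 mu2a] := mem_block a.
  have mu1b : mu1 \notin I b by rewrite (mem_other_block mu1b') // eq_sym.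
  have mu1a : mu1 \notin I a by rewrite (mem_other_block mu1b') // eq_sym.
  have e1 := chi2_left b'a mu1b'; have e2 := chi2_out mu1b mu1a.
  have e3 := chi2_right b'a mu2a; have e4 := chi2_right ba mu2a.
  rewrite ob ob' (negPf ea) /= in e1 e2 e3 e4.
  split; split.
  - by apply: (@proj_eq0 _ _ _ mu1 _ (typed_blk2 b' a)); rewrite e1 e2.
  - by apply: (@proj_eq0 _ _ _ mu2 _ (typed_Gs_blk2 b' a)); rewrite e3 e4.
  - by apply: (@proj_eq0 _ _ _ mu2 _ (typed_blk2 b' a)); rewrite e3 e4.
  - by apply: (@proj_eq0 _ _ _ mu1 _ (typed_Gs_blk2 b' a)); rewrite e1 e2.
have [mu2 mu2a] := mem_block a.
have odd1 : odd #|chi2 b a| by rewrite odd_card_chi2 ob.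
have odd2 : odd #|(fun k => ~~ chi2 b a k) : pred 'I_n|.
  by rewrite odd_card_chi2C ob (negPf ea).
have E1 := proj_quad_coef_odd odd1 qz; have E2 := proj_quad_coef_odd odd2 qz.
rewrite (bigD1 b) //= big1 ?addr0 in E1; last first.
  move=> b' /andP[b'a b'b]; have [/(sep _ b'a b'b)[[-> ->] _]|/even0[-> ->]] := boolP (odd_block b').
    by rewrite !scaler0 addr0.
  by rewrite !mulr0 !scale0r addr0.
rewrite (bigD1 b) //= big1 ?addr0 in E2; last first.
  move=> b' /andP[b'a b'b]; have [/(sep _ b'a b'b)[_ [-> ->]]|/even0[-> ->]] := boolP (odd_block b').
    by rewrite !scaler0 addr0.
  by rewrite !mulr0 !scale0r addr0.
have typed2C := typed_Gs_blk2 b a.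
rewrite (proj_id _ (typed_blk2 b a)) // (@proj_eq0 _ _ _ mu2 _ typed2C) in E1; last first.
  by case: (chi2 b a mu2).
rewrite (@proj_eq0 _ _ _ mu2 _ (typed_blk2 b a)) ?(proj_id _ typed2C) // in E2; last first.
  by case: (chi2 b a mu2).
rewrite scaler0 addr0 in E1; rewrite scaler0 add0r in E2.
have {E1} := scale_blk2_eq0 E1; have {E2} := scale_blk2_eq0 (scale_Gs_eq0 E2).
rewrite /comm_coef /comm_coef_Gs ob (negPf ea) /= !mulr0n !mulr1n !add0r !mulrN.
move=> /eqP; rewrite mulrA oppr_eq0 mulf_eq0 (negPf ne0) /= => /eqP E2.
move=> /eqP; rewrite mulrA oppr_eq0 mulf_eq0 (negPf ne0) /= => /eqP E1.
by rewrite mulrC E2 mulrC E1.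
Qed.

(** * The quadratic map when even and odd blocks are decoupled *)

Hypothesis even_ch0 : forall a b, ~~ odd_block a -> odd_block b -> ch a = 0.

Lemma quad_coef_decoupled a : quad_coef a =
  (4%:R * block_square a)%:A + full_coef a *: Gs +
  \sum_(b | b != a) (4%:R * block_pairing b a *+ (odd_block b && odd_block a))
    *: (P b * P a).
Proof.
rewrite quad_coefE; congr (_ + _); apply: eq_bigr => b ba.
have -> : comm_coef_Gs b a = 0.
  rewrite /comm_coef_Gs; case: (boolP (odd_block b)) => ob; case: (boolP (odd_block a)) => oa /=.
  - by ring.
  - by rewrite (even_ch0 oa ob); ring.
  - by rewrite (even_ch0 ob oa); ring.
  - by ring.
rewrite mulr0 scale0r addr0 /comm_coef; congr (_ *: _).
case: (boolP (odd_block b)) => ob; case: (boolP (odd_block a)) => oa /=.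
- by ring.
- by rewrite (even_ch0 oa ob); ring.
- by rewrite (even_ch0 ob oa); ring.
- by ring.
Qed.

Lemma full_coef_odd a : odd_block a -> full_coef a = 0.
Proof. by move=> oa; rewrite /full_coef oa expr1 subrr !mulr0. Qed.

(** Scalar parts are compared. [Gm mu] anticommutes with [Gs], and with [P b * P a] for two odd
    blocks, so these have none; on the right only the term of index [mu] is scalar. *)
Lemma quad_diag_coef mu a (z : 'I_n -> F) :
    mu \in I a -> quad_coef a * Gm mu = \sum_nu z nu *: Gm nu ->
  z mu = 4%:R * block_square a.
Proof.
move=> mua /quad_coef_pairs/(congr1 (proj pred0)).
rewrite quad_coef_decoupled !linearD !linear_sum /= !linearZ /= (proj_id _ typed1) //.
rewrite (@proj_eq0 _ _ _ mu _ typed_Gs) // scaler0 addr0.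
rewrite big1 ?addr0 => [|b ba]; last first.
  rewrite linearZ /=; case: (boolP (_ && _)) => [/andP[ob oa]|_]; last by rewrite scale0r.
  rewrite (@proj_eq0 _ _ _ mu _ (typed_blk2 b a)) ?scaler0 //.
  by rewrite (chi2_right ba mua) ob oa.
rewrite [RHS](bigD1 mu) //= [X in _ = _ + X]big1 ?addr0 => [|nu numu]; last first.
  rewrite linearZ /= (@proj_eq0 _ _ _ nu _ (typed_Gm2 nu mu)) ?scaler0 //.
  by rewrite eqxx numu.
rewrite linearZ /= (proj_id _ (typed_Gm2 mu mu)); last by move=> k; rewrite /= addbb.
by rewrite Gm_sqr scaleNr scalerN opprK => /scale1_inj.
Qed.

(** An even block has two distinct indices. Exchanging them changes the sign of the product of their
    generators but not [z], so the [Gs] part equals its own negative. Its projection can be nonzero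
    only for n = 2, where a product of two distinct generators has the type of [Gs]. *)
Lemma full_coef_eq0 a (z : 'I_n -> 'I_n -> F) : (forall mu nu, z mu nu = z nu mu) ->
    (forall mu, mu \in I a -> quad_coef a * Gm mu = \sum_nu z mu nu *: Gm nu) ->
  full_coef a = 0.
Proof.
move=> zC qz; have [/full_coef_odd //|ea] := boolP (odd_block a).
have [mu [nu [mua nua numu]]] : exists mu nu, [/\ mu \in I a, nu \in I a & nu != mu].
  case: (I a) (I_uniq a) (I_neq0 a) ea => [//|mu [//|nu s]] /= /andP[mun _] _ _.
  exists mu, nu; rewrite mem_head !in_cons eqxx orbT; split => //.
  by rewrite eq_sym; apply: contraNneq mun => ->; rewrite mem_head.
have step i j : i \in I a -> j \in I a -> j != i ->
    full_coef a *: Gs = (- z i j) *: proj predT (Gm j * Gm i).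
  move=> ia ja ji; have := quad_coef_pairs (qz i ia).
  move=> /(congr1 (proj predT)).
  rewrite quad_coef_decoupled !linearD !linear_sum /= !linearZ /= (proj_id _ typed_Gs) //.
  rewrite (@proj_eq0 _ _ _ mu _ typed1) // scaler0 add0r.
  rewrite big1 ?addr0 => [->|b ba]; last first.
    by rewrite (negPf ea) andbF scale0r linear0.
  rewrite (bigD1 j) //= big1 ?addr0 ?linearZ // => k kj.
  rewrite linearZ /= (@proj_eq0 _ _ _ j _ (typed_Gm2 k i)) ?scaler0 //.
  by rewrite (eq_sym j) kj ji.
have E1 := step _ _ mua nua numu.
have munu : mu != nu by rewrite eq_sym.
have := step _ _ nua mua munu; rewrite Gm_anti // linearN /= scalerN -scaleNr zC.
rewrite scaleNr -E1 => /eqP; rewrite -subr_eq0 opprK -mulr2n -scaler_nat scalerA.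
move=> /eqP /(congr1 ( *%R Gs)); rewrite mulr0 -scalerAr Gs_sqr => /eqP.
by rewrite scaler_eq0 oner_eq0 orbF mulf_eq0 pnatr_eq0 => /eqP.
Qed.

(** [P b * P a] anticommutes with all indices of both odd blocks, at least four in number, whereas a
    product of two generators anticommutes with at most two. *)
Lemma odd_pairing_eq0 mu a b (z : 'I_n -> F) :
    b != a -> odd_block a -> odd_block b -> (1 < size (I a))%N || (1 < size (I b))%N ->
    mu \in I a -> quad_coef a * Gm mu = \sum_nu z nu *: Gm nu ->
  block_pairing b a = 0.
Proof.
move=> ba oa ob ab_gt1 mua /quad_coef_pairs/(congr1 (proj (chi2 b a))).
(* Two indices besides [mu]: any [Gm nu * Gm mu] commutes with the generator of at least one of
   them. *)
have [k [l [kl kmu lmu chik chil]]] : exists k l,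
    [/\ k != l, k != mu, l != mu, chi2 b a k & chi2 b a l].
  have cab k : (k \in I a) || (k \in I b) -> chi2 b a k.
    case/orP => h; last by rewrite (chi2_left ba h) oa ob.
    by rewrite (chi2_right ba h) oa ob.
  have [nu nub] := mem_block b.
  have bmu k : k \in I b -> k != mu.
    by apply: contraTneq => ->; rewrite (mem_other_block mua ba).
  case/orP: ab_gt1 => gt1.
    have [k ka kmu] : exists2 k, k \in I a & k != mu.
      case: (I a) (I_uniq a) gt1 {cab mua bmu} => [//|i [//|j s]] /= /andP[ij _] _.
      case: (eqVneq i mu) => [<-|]; last by exists i; rewrite ?mem_head.
      exists j; first by rewrite !in_cons eqxx orbT.
      by apply: contraNneq ij => ->; rewrite mem_head.
    exists k, nu; rewrite kmu bmu // !cab ?ka ?nub ?orbT //; split=> //.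
    by apply: contraTneq nub => <-; rewrite (mem_other_block ka ba).
  have [k kb knu] : exists2 k, k \in I b & k != nu.
    case: (I b) (I_uniq b) gt1 {cab nub bmu} => [//|i [//|j s]] /= /andP[ij _] _.
    case: (eqVneq i nu) => [<-|]; last by exists i; rewrite ?mem_head.
    exists j; first by rewrite !in_cons eqxx orbT.
    by apply: contraNneq ij => ->; rewrite mem_head.
  by exists k, nu; rewrite knu !bmu // !cab ?kb ?nub ?orbT.
rewrite quad_coef_decoupled (full_coef_odd oa) scale0r addr0 linearD !linear_sum /=.
have [nu nub] := mem_block b.
rewrite linearZ /= (@proj_eq0 _ _ _ mu _ typed1) ?scaler0 ?add0r; last first.
  by rewrite (chi2_right ba mua) ob oa.
rewrite (bigD1 b) //= big1 ?addr0 => [|b' /andP[b'a b'b]]; last first.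
  rewrite linearZ /=; case: (boolP (_ && _)) => [/andP[ob' _]|_]; last by rewrite scale0r.
  have [i ib'] := mem_block b'.
  rewrite (@proj_eq0 _ _ _ i _ (typed_blk2 b' a)) ?scaler0 //.
  rewrite (chi2_left b'a ib') chi2_out ?(mem_other_block ib') ?ob' ?ob ?oa //.
    by rewrite eq_sym.
  by rewrite eq_sym.
rewrite big1 => [|nu' _]; last first.
  rewrite linearZ /=; have [E|nek] := eqVneq k nu'.
    rewrite (@proj_eq0 _ _ _ l _ (typed_Gm2 nu' mu)) ?scaler0 //.
    by rewrite chil -E (eq_sym l) kl lmu.
  rewrite (@proj_eq0 _ _ _ k _ (typed_Gm2 nu' mu)) ?scaler0 //.
  by rewrite chik nek kmu.
rewrite linearZ /= (proj_id _ (typed_blk2 b a)) // oa ob => /scale_blk2_eq0 /eqP.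
by rewrite mulr1n mulf_eq0 pnatr_eq0 => /eqP.
Qed.

Lemma quad_coef_scalar a :
    full_coef a = 0 -> (forall b, b != a -> odd_block a -> odd_block b -> block_pairing b a = 0) ->
  quad_coef a = (4%:R * block_square a)%:A.
Proof.
move=> fa orth; rewrite quad_coef_decoupled fa scale0r addr0 big1 ?addr0 // => b ba.
case: (boolP (_ && _)) => [/andP[ob oa]|_]; last by rewrite scale0r.
by rewrite orth // mulr0 scale0r.
Qed.

(** Off the diagonal only pairs of single vectors interact, and there [P b * P a * Gm (rep a)] is
    [- Gm (rep b)]. So the representatives of the odd blocks span an invariant space, on which the
    map is a Gram matrix up to the signs [block_sign a]. *)
Lemma quad_coef_odd_rep (rep : A -> 'I_n) a :
    (forall b, rep b \in I b) ->
    (forall b, b != a -> odd_block b -> (1 < size (I a))%N || (1 < size (I b))%N ->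
       block_pairing b a = 0) ->
    odd_block a ->
  quad_coef a * Gm (rep a) =
  \sum_(b | odd_block b) (4%:R * block_sign a * block_pairing b a) *: Gm (rep b).
Proof.
move=> repI orth oa.
rewrite quad_coef_decoupled (full_coef_odd oa) scale0r addr0 [RHS](bigD1 a) //= mulrDl.
congr (_ + _).
  by rewrite -scalerAl mul1r /block_square /block_pairing oa; congr (_ *: _); ring.
have sing b : size (I b) = 1%N -> P b = Gm (rep b).
  have := repI b; case: (I b) => [//|i [|//]]; rewrite inE => /eqP -> _.
  by rewrite monom_cons /monom big_nil mulr1.
rewrite mulr_suml [RHS]big_mkcondl [RHS]big_mkcond [LHS]big_mkcond /=.
apply: eq_bigr => b _; case: (eqVneq b a) => [-> //|ba] /=.
rewrite oa andbT; case: (boolP (odd_block b)) => ob /=; last by rewrite scale0r mul0r.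
have [gt1|] := boolP ((1 < size (I a))%N || (1 < size (I b))%N).
  by rewrite orth // !mulr0 !scale0r mul0r.
have sz_gt0 b' : (0 < size (I b'))%N by case: (I b') (I_neq0 b').
rewrite negb_or -!leqNgt => /andP[a1 b1].
have a1' : size (I a) = 1%N by apply/eqP; rewrite eqn_leq a1 sz_gt0.
have b1' : size (I b) = 1%N by apply/eqP; rewrite eqn_leq b1 sz_gt0.
rewrite (sing a) // (sing b) // -scalerAl -(mulrA (Gm _)) Gm_sqr mulrN1 scalerN -scaleNr.
(* For a block of size 1 [block_sign] is -1, which absorbs the sign from the square of the
   generator. *)
by rewrite /block_sign a1' mulr1n; congr (_ *: _); rewrite (_ : 'C(2, 2) = 1%N) // expr1; ring.
Qed.

End CliffordMonomials.

(** For n = 2m the scalar squares to (-1)^m, and the product of the generators to a sign with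
    exponent m(2m+1), of the same parity as m. *)
Lemma volume_sqr (F : numFieldType) (B : algType F) (n : nat) (Gm : 'I_n -> B) (i : F) :
    (forall mu, Gm mu * Gm mu = -1) ->
    (forall mu nu, mu != nu -> Gm mu * Gm nu = - (Gm nu * Gm mu)) ->
    ~~ odd n -> i ^+ 2 = -1 ->
  let Gs := i ^+ (n.+1)./2 *: \prod_(mu < n) Gm mu in
  Gs * Gs = 1 /\ forall mu, Gm mu * Gs = - (Gs * Gm mu).
Proof.
move=> Gm_sqr Gm_anti n_even i2 /=.
have -> : \prod_(mu < n) Gm mu = \prod_(mu <- enum 'I_n) Gm mu.
  by rewrite enumT [index_enum _]unlock.
have := monom_sqr Gm_sqr Gm_anti (enum_uniq 'I_n).
have := typed_monom Gm_anti (enum_uniq 'I_n).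
rewrite size_enum_ord /monom; set p := \prod_(mu <- _) _ => tp p2; split.
  rewrite -scalerAl -scalerAr p2 !scalerA -exprD addnn -mul2n exprM i2.
  rewrite -[_ ^+ uphalf n]signr_odd -[_ ^+ 'C(_, _)]signr_odd -signr_addb.
  have -> : odd (uphalf n) = odd 'C(n.+1, 2).
    rewrite -(even_halfK n_even) bin2 /= -doubleMr doubleK uphalf_double.
    by rewrite oddM /= odd_double.
  by rewrite addbb scale1r.
move=> mu; rewrite -scalerAr -scalerAl tp mem_enum (negPf n_even) scaleN1r.
by rewrite scalerN.
Qed.

(** * Orthonormal bases and diagonal endomorphisms *)

Section Bilinear.
Variables (R : realType) (V : vectType R) (g : {dot V for idfun}).

Lemma dotC u v : g u v = g v u.
Proof. by rewrite hermC /= mul1r. Qed.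

Lemma dot_eq0 v : g v v = 0 -> v = 0.
Proof.
move=> gv0; apply: contra_eq gv0 => /(@neq0_dnorm_gt0 _ _ _ g).
by rewrite lt0r => /andP[].
Qed.

Variables (n : nat) (e : n.-tuple V).
Hypothesis e_basis : basis_of fullv e.
Hypothesis e_orth : forall mu nu, g (tnth e mu) (tnth e nu) = (mu == nu)%:R.

Lemma dot_sum_basis (x : 'I_n -> R) mu : g (tnth e mu) (\sum_nu x nu *: tnth e nu) = x mu.
Proof.
rewrite linear_sum (bigD1 mu) //= linearZ /= e_orth eqxx mulr1 big1 ?addr0 //.
by move=> nu numu; rewrite linearZ /= e_orth eq_sym (negPf numu) mulr0.
Qed.

Lemma orthonormal_expansion v : v = \sum_mu g (tnth e mu) v *: tnth e mu.
Proof.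
have := coord_basis e_basis (memvf v).
under eq_bigr do rewrite -tnth_nth.
by move=> {1 2}->; apply: eq_bigr => mu _; rewrite dot_sum_basis.
Qed.

Lemma tnth_basis_neq0 mu : tnth e mu != 0.
Proof.
apply/eqP => e0; have := e_orth mu mu; rewrite e0 linear0 eqxx => /eqP.
by rewrite eq_sym oner_eq0.
Qed.

Definition diag_fun (d : 'I_n -> R) (v : V) : V :=
  \sum_mu (d mu * g (tnth e mu) v) *: tnth e mu.

Fact diag_fun_is_linear d : linear (diag_fun d).
Proof.
move=> r u v; rewrite /diag_fun scaler_sumr -big_split; apply: eq_bigr => mu _ /=.
by rewrite linearP scalerA -scalerDl mulrDr; congr (_ *: _); rewrite /=; ring.
Qed.

HB.instance Definition _ d :=
  GRing.isLinear.Build R V V _ (diag_fun d) (diag_fun_is_linear d).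

End Bilinear.

(** * Clifford maps and their injectivity *)

Section CliffordMap.
Variables (R : realType) (V : vectType R) (g : {dot V for idfun}).
Variables (Cl : algType R[i]) (iota : V -> Cl).
Hypothesis iota_clifford : clifford_map g iota.

Lemma iota_lin r u v : iota (r *: u + v) = r%:C *: iota u + iota v.
Proof. by case: iota_clifford. Qed.

Lemma iota0 : iota 0 = 0.
Proof.
have := iota_lin (-1) 0 0.
by rewrite scaler0 addr0 rmorphN1 scaleN1r addNr.
Qed.

Lemma iota_sum (T : finType) (x : T -> R) (v : T -> V) :
  iota (\sum_t x t *: v t) = \sum_t (x t)%:C *: iota (v t).
Proof.
elim/big_rec2: _ => [|t _ y _ <-]; first exact: iota0.
exact: iota_lin.
Qed.

Lemma iota_sqr v : iota v * iota v = (- g v v)%:C%:A.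
Proof.
have two0 : 2%:R != 0 :> R[i] by rewrite pnatr_eq0.
apply: (scalerI two0); rewrite scaler_nat mulr2n; case: iota_clifford => _ ->.
by rewrite scalerA; congr (_ *: _); rewrite !rmorphM !rmorphN /= rmorph_nat; ring.
Qed.

(** Squaring both sides of the relation gives g u u + g w w = 0, and g is positive definite. So even
    the complexification of [iota] is injective. *)
Lemma iota_complex_eq0 u w : iota u + 'i *: iota w = 0 -> u = 0 /\ w = 0.
Proof.
move=> /eqP; rewrite addr_eq0 => /eqP uw.
have := congr1 (fun x => x * x) uw; rewrite /= mulrNN -scalerAl -scalerAr scalerA.
rewrite -(expr2 'i) sqr_i !iota_sqr scalerA => /scale1_inj.
rewrite mulN1r -rmorphN opprK => /complexI guw.
have pos v : 0 <= g v v.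
  by have [->|/(@neq0_dnorm_gt0 _ _ _ g)/ltW //] := eqVneq v 0; rewrite linear0.
have [gu gw] : g u u = 0 /\ g w w = 0 by have := pos u; have := pos w; lra.
by split; apply: dot_eq0; [exact: gu|exact: gw].
Qed.

Lemma iota_eq0 u : iota u = 0 -> u = 0.
Proof.
by move=> u0; case: (@iota_complex_eq0 u 0) => //; rewrite u0 iota0 scaler0 addr0.
Qed.

Fact quad_is_linear a b : linear (@quad R Cl a b).
Proof.
move=> z x y; rewrite /quad; move: 2%:R => t; rewrite !mulrDr !mulrDl -!scalerAl -!scalerAr.
rewrite scalerBr scalerDr -!scalerAl mulrDr -scalerAr opprD.
by rewrite [X in X + _ = _]addrACA; apply: addrACA.
Qed.

HB.instance Definition _ a b :=
  GRing.isLinear.Build R[i] Cl Cl _ (@quad R Cl a b) (quad_is_linear a b).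

Variables (n : nat) (e : n.-tuple V).
Hypothesis e_basis : basis_of fullv e.
Hypothesis e_orth : forall mu nu, g (tnth e mu) (tnth e nu) = (mu == nu)%:R.

Local Notation Gm := (Gamma iota e).

Lemma Gamma_sqr mu : Gm mu * Gm mu = -1.
Proof. by rewrite /Gamma iota_sqr e_orth eqxx rmorphN1 scaleN1r. Qed.

Lemma Gamma_anti mu nu : mu != nu -> Gm mu * Gm nu = - (Gm nu * Gm mu).
Proof.
move=> munu; apply/eqP; rewrite -addr_eq0 /Gamma; case: iota_clifford => _ ->.
by rewrite e_orth (negPf munu) mulr0 scale0r.
Qed.

Lemma iota_expansion v : iota v = \sum_mu (g (tnth e mu) v)%:C *: Gm mu.
Proof. by rewrite {1}(orthonormal_expansion e_basis e_orth v) iota_sum. Qed.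

(** [diag_fun] is the required endomorphism; since [iota] is injective, any [f] has the same values
    on the basis. *)
Lemma diag_nondeg_pair a b (d : 'I_n -> R) :
    (forall mu, quad a b (Gm mu) = (d mu)%:C *: Gm mu) -> (forall mu, d mu != 0) ->
  nondeg_quadratic_clifford_pair g iota a b.
Proof.
move=> qd d0; split.
  exists (linfun (diag_fun g e d)); split.
    move=> v; rewrite lfunE /= /diag_fun iota_sum iota_expansion linear_sum.
    by apply: eq_bigr => mu _; rewrite linearZ /= qd scalerA rmorphM mulrC.
  move=> v w; rewrite !lfunE /= dotC /diag_fun !linear_sum; apply: eq_bigr => mu _.
  by rewrite !linearZ /= (dotC g w) (dotC g v) /=; ring.
move=> f qf; apply/eqP; rewrite -subv0; apply/subvP => v; rewrite memv_ker memv0.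
move=> /eqP fv0; have fe mu : f (tnth e mu) = d mu *: tnth e mu.
  apply/eqP; rewrite -subr_eq0; apply/eqP/iota_eq0.
  rewrite -scaleN1r addrC iota_lin -qf qd rmorphN1 scaleN1r.
  by rewrite -[d mu *: _]addr0 iota_lin iota0 addr0 addNr.
have S0 : \sum_mu (g (tnth e mu) v * d mu) *: tnth e mu = 0.
  rewrite -[RHS]fv0 [in RHS](orthonormal_expansion e_basis e_orth v) linear_sum.
  by apply: eq_bigr => mu _; rewrite linearZ /= fe scalerA.
rewrite (orthonormal_expansion e_basis e_orth v).
apply/eqP/big1 => mu _; have := dot_sum_basis e_orth (fun mu => g (tnth e mu) v * d mu) mu.
rewrite S0 linear0 => /esym/eqP; rewrite mulf_eq0 (negPf (d0 mu)) orbF => /eqP ->.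
by rewrite scale0r.
Qed.

End CliffordMap.

(** * Quadratic Clifford pairs *)

Section Blocks.
Variables (R : realType) (V : vectType R) (g : {dot V for idfun}).
Variables (Cl : algType R[i]) (iota : V -> Cl).
Hypothesis iota_clifford : clifford_map g iota.
Variables (n : nat) (n_even : ~~ odd n) (e : n.-tuple V).
Hypothesis e_basis : basis_of fullv e.
Hypothesis e_orth : forall mu nu, g (tnth e mu) (tnth e nu) = (mu == nu)%:R.
Variables (A : finType) (I : A -> seq 'I_n).
Hypothesis I_uniq : forall a, uniq (I a).
Hypothesis I_neq0 : forall a, I a != [::].
Hypothesis I_disj : forall a b, a != b -> [disjoint I a & I b].
Hypothesis I_cover : ~: (\bigcup_a [set mu in I a]) = set0.
Variables c ch : A -> R[i].

Local Notation Gm := (Gamma iota e).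
Local Notation Gs := (GammaStar iota e).
Local Notation odd_block a := (odd (size (I a))).
Local Notation cc := (pair_c iota e I c ch).
Local Notation dd := (pair_d iota e I c ch).
Local Notation bcoef := (quad_coef Gm Gs I c ch).

Let Gm_sqr := Gamma_sqr iota_clifford e_orth.
Let Gm_anti := Gamma_anti iota_clifford e_orth.

Fact Gs_volume : Gs * Gs = 1 /\ forall mu, Gm mu * Gs = - (Gs * Gm mu).
Proof. exact: volume_sqr Gm_sqr Gm_anti n_even (sqr_i R). Qed.

Let Gs_sqr := Gs_volume.1.
Let Gs_anti := Gs_volume.2.

Lemma pair_c_blocks : cc = blocks Gm Gs I c ch.
Proof. by rewrite blocksE. Qed.

Lemma pair_d_blocks : dd = blocks_twist Gm Gs I c ch.
Proof. by rewrite blocks_twistE. Qed.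

Lemma quad_pair_Gamma mu a : mu \in I a -> quad cc dd (Gm mu) = bcoef a * Gm mu.
Proof.
move=> mua; rewrite /quad pair_c_blocks pair_d_blocks.
exact: (quad_Gm Gm_anti Gs_anti I_uniq I_disj _ _ mua).
Qed.

Lemma covered mu : exists a, mu \in I a.
Proof.
have : mu \notin ~: (\bigcup_a [set mu in I a]) by rewrite I_cover inE.
by rewrite inE negbK => /bigcupP[a _]; rewrite inE => mua; exists a.
Qed.

Lemma even_number_odd_blocks : \big[addb/false]_a odd_block a = false.
Proof.
have [k kI] := fin_all_exists covered.
apply: etrans (negbTE n_even).
rewrite -[in RHS](card_ord n) -sum1_card (partition_big k predT) //=.
rewrite (big_morph odd oddD (erefl _)); apply: eq_bigr => a _.
rewrite sum1_card -(card_uniqP (I_uniq a)); congr odd; apply: eq_card => mu.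
rewrite [RHS]unfold_in /=; apply/idP/eqP => [mua|<- //].
apply/eqP; apply: contraTT mua => kna.
by rewrite (mem_other_block I_disj (kI mu)) // eq_sym.
Qed.

(** Together these conditions leave only the scalar term of [quad_coef_decoupled]. *)
Lemma type_decoupled : type1 I c ch \/ type2 I c ch ->
  [/\ forall a b, ~~ odd_block a -> odd_block b -> ch a = 0,
      forall a, full_coef I c ch a = 0 &
      forall a b, b != a -> odd_block a -> odd_block b -> block_pairing c ch b a = 0].
Proof.
case=> [[ev cch]|[a0 [a1 [a01 o0 o1 ev cch]]]].
  split=> [a b _|a|a b _]; try by rewrite (negPf (ev _)).
  by rewrite /full_coef (mulrC (c a)) cch mul0r !mulr0.
have odd01 a : odd_block a -> (a == a0) || (a == a1).
  move=> oa; have [//|n0] := eqVneq a a0; have [//|n1] := eqVneq a a1.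
  by have [] := ev a n0 n1; rewrite oa.
have ch0 a : ~~ odd_block a -> ch a = 0.
  move=> ea; have [a0E|n0] := eqVneq a a0; first by rewrite a0E o0 in ea.
  have [a1E|n1] := eqVneq a a1; first by rewrite a1E o1 in ea.
  by have [] := ev a n0 n1.
split=> [a b ea _|a|a b ba oa ob].
- exact: ch0.
- rewrite /full_coef; have [oa|ea] := boolP (odd_block a); first by rewrite expr1 subrr !mulr0.
  by rewrite ch0 // mulr0 mul0r !mulr0.
rewrite /block_pairing; case/orP: (odd01 a oa) ba => /eqP ->; case/orP: (odd01 b ob) => /eqP -> //.
- by rewrite eqxx.
- by rewrite mulrC cch mulrC subrr.
- by rewrite cch subrr.
- by rewrite eqxx.
Qed.

Lemma quad_type_scalar a : type1 I c ch \/ type2 I c ch ->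
  bcoef a = (4%:R * block_square I c ch a)%:A.
Proof.
move=> /type_decoupled[ev fu orth].
by rewrite (quad_coef_scalar Gm_sqr Gm_anti Gs_sqr Gs_anti) // => b; apply: orth.
Qed.

Lemma block_sign_real a : block_sign R[i] I a = ((-1) ^+ 'C((size (I a)).+1, 2) : R)%:C.
Proof. by rewrite /block_sign rmorph_sign. Qed.

(** The map is then diagonal with eigenvalue 4 [block_square] on each block, and [proper_summands]
    makes this real and nonzero. *)
Lemma type_nondeg : proper_summands I c ch -> type1 I c ch \/ type2 I c ch ->
  nondeg_quadratic_clifford_pair g iota cc dd.
Proof.
move=> prop ty; have [r r0 rP] := fin_all_exists2 prop; have [k kI] := fin_all_exists covered.
pose d mu : R := 4%:R * ((-1) ^+ 'C((size (I (k mu))).+1, 2) * r (k mu)).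
apply: (diag_nondeg_pair iota_clifford e_basis e_orth (d := d)) => mu.
  rewrite (quad_pair_Gamma (kI mu)) quad_type_scalar // -scalerAl mul1r; congr (_ *: _).
  by rewrite /d rmorphM rmorph_nat rmorphM /= -block_sign_real -rP /block_square signr_odd.
by rewrite /d !mulf_neq0 ?pnatr_eq0 ?signr_eq0 // r0.
Qed.

(** * Necessity of the two types *)

Section Necessity.
Variable f : 'End(V).
Hypothesis f_quad : quad_restr iota cc dd f.
Hypothesis f_sym : g_symmetric g f.
Hypothesis f_inj : lker f = 0%VS.

Definition pair_mx mu nu : R[i] := (g (tnth e mu) (f (tnth e nu)))%:C.

Lemma pair_mxC mu nu : pair_mx mu nu = pair_mx nu mu.
Proof. by rewrite /pair_mx -f_sym dotC. Qed.

Lemma bcoef_Gamma mu a : mu \in I a -> bcoef a * Gm mu = \sum_nu pair_mx mu nu *: Gm nu.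
Proof.
move=> mua; rewrite -quad_pair_Gamma // f_quad (iota_expansion iota_clifford e_basis e_orth).
by apply: eq_bigr => nu _; rewrite [in RHS]pair_mxC.
Qed.

Lemma f_eq0 v : f v = 0 -> v = 0.
Proof. by move=> fv0; apply/eqP; rewrite -memv0 -f_inj memv_ker fv0. Qed.

Lemma bcoef_neq0 a : bcoef a != 0.
Proof.
have [mu mua] := mem_block I_neq0 a; apply/eqP => b0.
have := quad_pair_Gamma mua; rewrite b0 mul0r f_quad => /(iota_eq0 iota_clifford).
by move=> /f_eq0/eqP; rewrite (negPf (tnth_basis_neq0 e_orth mu)).
Qed.

(** Were [ch a] nonzero, the block of [b] would vanish, and with it [bcoef b]. *)
Lemma decoupled a b : ~~ odd_block a -> odd_block b -> ch a = 0.
Proof.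
move=> ea ob; have [mu mua] := mem_block I_neq0 a.
have [cb chb] : ch a * c b = 0 /\ ch a * ch b = 0.
  exact: (even_block_ch Gm_sqr Gm_anti n_even Gs_sqr Gs_anti I_uniq I_disj I_neq0 (bcoef_Gamma mua)).
apply/eqP; apply: contraNT (bcoef_neq0 b) => cha0.
have blk0 : blk Gm Gs I c ch b = 0.
  move/eqP: cb; rewrite mulf_eq0 (negPf cha0) => /eqP cb0.
  move/eqP: chb; rewrite mulf_eq0 (negPf cha0) => /eqP chb0.
  by rewrite /blk cb0 chb0 !scale0r addr0.
rewrite /quad_coef blk0 mulr0 scaler0 add0r big1 ?scaler0 // => d _.
by rewrite mulr0 mul0r subrr.
Qed.

Lemma pair_full_coef a : full_coef I c ch a = 0.
Proof.
exact: (full_coef_eq0 Gm_sqr Gm_anti Gs_sqr Gs_anti I_uniq I_disj I_neq0 decoupled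
          pair_mxC (@bcoef_Gamma ^~ a)).
Qed.

Lemma pair_orth a b : b != a -> odd_block a -> odd_block b ->
  (1 < size (I a))%N || (1 < size (I b))%N -> block_pairing c ch b a = 0.
Proof.
move=> ba oa ob gt1; have [mu mua] := mem_block I_neq0 a.
exact: (odd_pairing_eq0 Gm_sqr Gm_anti Gs_sqr Gs_anti I_uniq I_disj I_neq0 decoupled
          ba oa ob gt1 mua (bcoef_Gamma mua)).
Qed.

(* A complex-linear extension of an injective real-linear map is injective. *)
Lemma quad_complex_inj (rep : A -> 'I_n) (w : A -> R[i]) : (forall a, rep a \in I a) ->
  \sum_a w a *: quad cc dd (Gm (rep a)) = 0 -> forall a, w a = 0.
Proof.
move=> repI w0.
pose comb (x : A -> R) := \sum_a x a *: tnth e (rep a).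
have f_comb x : f (comb x) = \sum_a x a *: f (tnth e (rep a)).
  by rewrite linear_sum; apply: eq_bigr => a _; rewrite linearZ.
pose u := comb (fun a => complex.Re (w a)); pose v := comb (fun a => complex.Im (w a)).
have wE a : w a = (complex.Re (w a))%:C + 'i * (complex.Im (w a))%:C.
  exact: complexE.
have [/f_eq0 u0 /f_eq0 v0] : f u = 0 /\ f v = 0.
  apply: (iota_complex_eq0 iota_clifford); rewrite -[RHS]w0 !f_comb.
  rewrite !(iota_sum iota_clifford) scaler_sumr -big_split; apply: eq_bigr => a _ /=.
  by rewrite {3}wE f_quad scalerDl !scalerA.
have rep_inj a b : a != b -> rep a == rep b = false.
  move=> ab; apply: contraTF (repI a) => /eqP ->.
  by rewrite (mem_other_block I_disj (repI b)).
have comb0 x a : comb x = 0 -> x a = 0.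
  move=> /(congr1 (g (tnth e (rep a)))); rewrite linear0 linear_sum (bigD1 a) //=.
  rewrite linearZ /= e_orth eqxx mulr1 big1 ?addr0 // => b ba.
  by rewrite linearZ /= e_orth rep_inj ?mulr0 // eq_sym.
by move=> a; rewrite wE (comb0 _ a u0) (comb0 _ a v0) mulr0 addr0.
Qed.

(** A relation among the vectors (c, ch) is one among the rows of the Gram matrix, so the map kills
    a combination of representatives; [quad_complex_inj] then applies. *)
Lemma odd_block_vectors_free (l : A -> R[i]) :
    (forall a, ~~ odd_block a -> l a = 0) ->
    \sum_a l a * c a = 0 -> \sum_a l a * ch a = 0 ->
  forall a, l a = 0.
Proof.
move=> l_odd lc lch a; have [rep repI] := fin_all_exists (mem_block I_neq0).
suff : l a * block_sign R[i] I a = 0.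
  by move=> /eqP; rewrite mulf_eq0 signr_eq0 orbF => /eqP.
(* The weights [block_sign] cancel the row signs of [quad_coef_odd_rep]. *)
apply: (quad_complex_inj (w := fun a => l a * block_sign R[i] I a) repI).
have step b : (l b * block_sign R[i] I b) *: quad cc dd (Gm (rep b)) =
    \sum_(d | odd_block d) (4%:R * l b * block_pairing c ch d b) *: Gm (rep d).
  have [ob|/l_odd ->] := boolP (odd_block b); last first.
    by rewrite mul0r scale0r big1 // => d _; rewrite mulr0 mul0r scale0r.
  rewrite (quad_pair_Gamma (repI b)).
  have -> := quad_coef_odd_rep Gm_sqr Gm_anti Gs_sqr Gs_anti I_uniq I_disj I_neq0
    decoupled repI (fun d db od => @pair_orth b d db ob od) ob.
  rewrite scaler_sumr; apply: eq_bigr => d _; rewrite scalerA; congr (_ *: _).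
  have -> : forall s t x y : R[i], x * s * (t * s * y) = s * s * (t * x * y) by move=> *; ring.
  by rewrite block_sign_sqr mul1r.
rewrite (eq_bigr _ (fun b _ => step b)) exchange_big big1 // => d _ /=.
rewrite -scaler_suml (_ : \sum_b _ = 0) ?scale0r //.
transitivity (4%:R * (c d * \sum_b l b * c b - ch d * \sum_b l b * ch b)); last first.
  by rewrite lc lch !mulr0 subrr mulr0.
rewrite !mulr_sumr -sumrB mulr_sumr; apply: eq_bigr => b _.
by rewrite /block_pairing; ring.
Qed.

(** Three vectors of a plane are dependent, which [odd_block_vectors_free] forbids. *)
Lemma no_three_odd_blocks a0 a1 a2 : a0 != a1 -> a0 != a2 -> a1 != a2 ->
  odd_block a0 -> odd_block a1 -> odd_block a2 -> False.
Proof.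
move=> n01 n02 n12 o0 o1 o2.
have free3 x y z : x * c a0 + y * c a1 + z * c a2 = 0 ->
    x * ch a0 + y * ch a1 + z * ch a2 = 0 -> [/\ x = 0, y = 0 & z = 0].
  move=> xc xch; pose l a := x *+ (a == a0) + y *+ (a == a1) + z *+ (a == a2).
  have sum_l h : \sum_a l a * h a = x * h a0 + y * h a1 + z * h a2.
    have delta w b : \sum_a (w *+ (a == b)) * h a = w * h b.
      rewrite (bigD1 b) //= eqxx big1 ?addr0 // => a /negPf ->.
      by rewrite mul0r.
    by rewrite -!delta -!big_split; apply: eq_bigr => a _; rewrite /l !mulrDl.
  have l0 a : l a = 0.
    apply: odd_block_vectors_free; rewrite ?sum_l // => b eb; rewrite /l.
    have ne d : odd_block d -> (b == d) = false by apply: contraTF => /eqP <-.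
    by rewrite !ne // !mulr0n !addr0.
  have := l0 a0; have := l0 a1; have := l0 a2; rewrite /l !eqxx (negPf n01) (negPf n02) (negPf n12).
  rewrite ![a1 == _]eq_sym ![a2 == _]eq_sym (negPf n01) (negPf n02) (negPf n12).
  by rewrite !mulr0n !mulr1n !add0r !addr0.
(* Cramer's relation between three vectors of a plane, then its degenerate cases. *)
have [||_ _ z0] := free3 (c a1 * ch a2 - ch a1 * c a2) (c a2 * ch a0 - ch a2 * c a0)
  (c a0 * ch a1 - ch a0 * c a1); [ring|ring|].
have [||_ c0 _] := free3 (c a1) (- c a0) 0; [ring| |].
  by transitivity (- (c a0 * ch a1 - ch a0 * c a1)); [ring|rewrite z0 oppr0].
have [||_ ch0 _] := free3 (ch a1) (- ch a0) 0; [ |ring|].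
  by transitivity (c a0 * ch a1 - ch a0 * c a1); [ring|rewrite z0].
move/eqP: c0; rewrite oppr_eq0 => /eqP c0; move/eqP: ch0; rewrite oppr_eq0 => /eqP ch0.
have [||] := free3 1 0 0; [rewrite c0; ring|rewrite ch0; ring|].
by move/eqP; rewrite oner_eq0.
Qed.

(** The number of odd blocks is even and below three. With none, the vanishing [Gs] part gives type
    1; with two, orthogonality gives type 2. *)
Lemma pair_type : ~ odd_part_two_vectors I -> type1 I c ch \/ type2 I c ch.
Proof.
move=> not2; have [a0 o0|ev] := pickP (fun a => odd_block a); last first.
  left; split=> [a|a]; first by rewrite ev.
  (* On an even block [full_coef] is 8 times the product of [c a] and [ch a], up to sign. *)
  have := pair_full_coef a; rewrite /full_coef ev expr0 => /eqP.
  rewrite !mulf_eq0 signr_eq0 -mulf_eq0 pnatr_eq0 (_ : 1 + 1 = 2%:R) // pnatr_eq0 orbF /=.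
  by rewrite mulrC => /eqP.
have [a1 /andP[n10 o1]|only] := pickP (fun a => (a != a0) && odd_block a); last first.
  have := even_number_odd_blocks; rewrite (bigD1 a0) //= o0 big1 // => a na.
  by have := only a; rewrite na.
have n01 : a0 != a1 by rewrite eq_sym.
have ev a : a != a0 -> a != a1 -> ~~ odd_block a.
  move=> n0 n1; apply/negP => oa.
  by apply: (no_three_odd_blocks n01 _ _ o0 o1 oa); rewrite eq_sym.
right; exists a0, a1; split=> // [a n0 n1|].
  by have ea := ev a n0 n1; split=> //; apply: decoupled ea o0.
apply/eqP; rewrite -subr_eq0; apply/eqP.
(* Orthogonality requires one of the blocks to have more than one index, which holds because two
   single vectors are excluded. *)
apply: (pair_orth (a := a1) (b := a0)) => //; apply/negbNE/negP; rewrite negb_or -!leqNgt.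
have sz_gt0 b : (0 < size (I b))%N by case: (I b) (I_neq0 b).
move=> /andP[le1 le0]; apply: not2; exists a0, a1; split=> //.
  by apply/eqP; rewrite eqn_leq le0 sz_gt0.
by apply/eqP; rewrite eqn_leq le1 sz_gt0.
Qed.

(** A diagonal entry of the real matrix of [f] is 4 [block_square], which is therefore real; it is
    nonzero because [bcoef a] is. *)
Lemma pair_proper : type1 I c ch \/ type2 I c ch -> proper_summands I c ch.
Proof.
move=> ty a; have [mu mua] := mem_block I_neq0 a.
have := quad_diag_coef Gm_sqr Gm_anti Gs_sqr Gs_anti I_uniq I_disj decoupled mua (bcoef_Gamma mua).
rewrite /pair_mx; set r := g _ _ => rE.
have sqE : block_square I c ch a = (4%:R^-1 * r)%:C.
  rewrite rmorphM fmorphV rmorph_nat /= rE mulKf // pnatr_eq0 //.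
exists ((-1) ^+ 'C((size (I a)).+1, 2) * (4%:R^-1 * r)).
  apply: contraNneq (bcoef_neq0 a) => /eqP; rewrite mulf_eq0 signr_eq0 /= => /eqP r0.
  by rewrite quad_type_scalar // sqE r0 mulr0 scale0r.
by rewrite rmorphM /= -sqE -block_sign_real /block_square [RHS]mulrA block_sign_sqr mul1r /eps signr_odd.
Qed.

End Necessity.
End Blocks.

(** gamma is the ratio of [c a0] to [ch a0]; the relation of type 2 says that [ch a1] to [c a1] has
    the same ratio. The nonzero coefficients [ch a0] and [c a1] become the prefactors. *)
Lemma type2_form (R : realType) (V : vectType R) (Cl : algType R[i]) (iota : V -> Cl)
    (n : nat) (e : n.-tuple V) (A : finType) (I : A -> seq 'I_n) (c ch : A -> R[i]) a0 a1 :
    type2_at I c ch a0 a1 -> ch a0 != 0 -> c a1 != 0 ->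
  let G := GammaI iota e in
  let Gs := GammaStar iota e in
  exists gamma : R[i],
    pair_c iota e I c ch =
      ch a0 *: ((gamma%:A + Gs) * G (I a0)) + c a1 *: ((1 + gamma *: Gs) * G (I a1))
      + \sum_(a | ~~ odd (size (I a))) c a *: G (I a) /\
    pair_d iota e I c ch =
      - ch a0 *: ((gamma%:A - Gs) * G (I a0)) - c a1 *: ((1 - gamma *: Gs) * G (I a1))
      + \sum_(a | ~~ odd (size (I a))) c a *: G (I a).
Proof.
move=> [n01 o0 o1 ev cch] ch0 c1 G Gs; exists (c a0 / ch a0).
have E0 : ch a0 * (c a0 / ch a0) = c a0 by rewrite mulrC divfK.
have E1 : c a1 * (c a0 / ch a0) = ch a1.
  by rewrite mulrA (mulrC (c a1)) cch (mulrC (ch a0)) mulfK.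
have ch_even a : ~~ odd (size (I a)) -> ch a = 0.
  move=> ea; have [] // := ev a; first by apply: contraNneq ea => ->.
  by apply: contraNneq ea => ->.
have split3 (F : A -> Cl) :
    \sum_a F a = F a0 + F a1 + \sum_(a | ~~ odd (size (I a))) F a.
  rewrite (bigD1 a0) //= (bigD1 a1) /=; last by rewrite eq_sym.
  rewrite addrA; congr (_ + _); apply: eq_bigl => a.
  have [->|na0] /= := eqVneq a a0; first by rewrite o0.
  have [->|na1] /= := eqVneq a a1; first by rewrite o1.
  by case: (ev a na0 na1) => ->.
have hat_sum (x : A -> R[i]) : \sum_(a | ~~ odd (size (I a))) (x a * ch a) *: G (I a) = 0.
  by rewrite big1 // => a /ch_even ->; rewrite mulr0 scale0r.
have hat_sum1 : \sum_(a | ~~ odd (size (I a))) ch a *: G (I a) = 0.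
  by rewrite big1 // => a /ch_even ->; rewrite scale0r.
rewrite /pair_c /pair_d !split3 hat_sum hat_sum1 !addr0 -/G -/Gs.
have even_sum : \sum_(a | ~~ odd (size (I a))) (eps R I a * c a) *: G (I a) =
    \sum_(a | ~~ odd (size (I a))) c a *: G (I a).
  by apply: eq_bigr => a ea; rewrite /eps -signr_odd (negPf ea) mul1r.
rewrite even_sum /epsh /eps; clearbody G Gs; split.
  rewrite addrAC; congr (_ + _).
  rewrite mulrDr !mulrDl !scalerDr -!scalerAr -!scalerAl !mul1r !scalerA E0 E1.
  by rewrite addrACA; congr (_ + _); rewrite addrC.
rewrite addrAC; congr (_ + _).
rewrite -[(-1) ^+ size (I a0)]signr_odd -[(-1) ^+ size (I a1)]signr_odd o0 o1 !expr1 opprK !mul1r.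
rewrite mulrDr !mulrBl !scalerBr -!scalerAr -!scalerAl !mul1r !scalerA.
rewrite !mulN1r !mulNr E0 E1 !scaleNr opprK opprB addrACA; congr (_ + _).
by rewrite addrC.
Qed.

Theorem proposition2p23
  (R : realType) (V : vectType R) (g : {dot V for idfun})
  (Cl : algType R[i]) (iota : V -> Cl) (hCl : clifford_algebra g iota)
  (n : nat) (hn : ~~ odd n)
  (e : n.-tuple V) (he : basis_of fullv e)
  (heg : forall mu nu, g (tnth e mu) (tnth e nu) = (mu == nu)%:R)
  (A : finType) (I : A -> seq 'I_n)
  (hIuniq : forall a, uniq (I a))
  (hIne : forall a, I a != [::])
  (hIdisj : forall a b, a != b -> [disjoint I a & I b])
  (hIcover : ~: (\bigcup_a [set mu in I a]) = set0)
  (c ch : A -> R[i]) :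
  let cc := pair_c iota e I c ch in
  let dd := pair_d iota e I c ch in
  let G := GammaI iota e in
  let Gs := GammaStar iota e in
  [/\ proper_summands I c ch /\ (type1 I c ch \/ type2 I c ch) ->
        nondeg_quadratic_clifford_pair g iota cc dd,
      ~ odd_part_two_vectors I ->
        nondeg_quadratic_clifford_pair g iota cc dd ->
        proper_summands I c ch /\ (type1 I c ch \/ type2 I c ch) &
      forall a0 a1, type2_at I c ch a0 a1 -> ch a0 != 0 -> c a1 != 0 ->
        exists gamma : R[i],
          cc = ch a0 *: ((gamma%:A + Gs) * G (I a0))
             + c a1 *: ((1 + gamma *: Gs) * G (I a1))
             + \sum_(a | ~~ odd (size (I a))) c a *: G (I a) /\
          dd = - ch a0 *: ((gamma%:A - Gs) * G (I a0))
             - c a1 *: ((1 - gamma *: Gs) * G (I a1))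
             + \sum_(a | ~~ odd (size (I a))) c a *: G (I a)].
Proof.
have iotaP : clifford_map g iota by case: hCl.
move=> cc dd G Gs; split.
- case=> prop ty.
  exact: (type_nondeg iotaP hn he heg hIuniq hIdisj hIcover prop ty).
- move=> not2 [[f [fq fs]] fi]; have f_inj := fi f fq.
  have ty : type1 I c ch \/ type2 I c ch.
    exact: (pair_type iotaP hn he heg hIuniq hIne hIdisj hIcover fq fs f_inj not2).
  split=> //.
  exact: (pair_proper iotaP hn he heg hIuniq hIne hIdisj fq fs f_inj ty).
- exact: type2_form.
Qed.
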